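(* Under $\mathcal H_0(\boldsymbol T):\boldsymbol T\boldsymbol\mu=\mathbf 0$ and one of the asymptotic frameworks (I)–(V), let $f_P=\operatorname{tr}^3((\boldsymbol T\boldsymbol V_N)^2)/\operatorname{tr}^2((\boldsymbol T\boldsymbol V_N)^3)$ and $K_{f_P}=(\chi^2_{f_P}-f_P)/\sqrt{2f_P}$, where $\chi^2_{f}$ denotes a chi-squared random variable with (real) $f>0$ degrees of freedom. Then (a) if $\beta_1\to0$, $K_{f_P}$ converges in distribution to $\mathcal N(0,1)$; (b) if $\beta_1\to1$, $K_{f_P}$ converges in distribution to $(\chi^2_1-1)/\sqrt2$.
   Context: Model: there are $a$ independent groups; for $i=1,\dots,a$, $j=1,\dots,n_i$, $\boldsymbol X_{i,j}\sim\mathcal N_d(\boldsymbol\mu_i,\boldsymbol\Sigma)$ independent, $\boldsymbol\Sigma$ a common positive definite $d\times d$ matrix, $N=\sum_in_i$, $n_{\max}=\max_in_i$. $\boldsymbol T=\boldsymbol T_W\otimes\boldsymbol T_S$ with $\boldsymbol T_W$ ($a\times a$) and $\boldsymbol T_S$ ($d\times d$) nonzero symmetric idempotent matrices. $\boldsymbol V_N=\bigoplus_{i=1}^a\frac{N}{n_i}\boldsymbol\Sigma$ (block diagonal); $\lambda_1\ge\dots\ge\lambda_{ad}$ are the eigenvalues of $\boldsymbol T\boldsymbol V_N\boldsymbol T$ and $\beta_1=\lambda_1/\sqrt{\sum_{\ell=1}^{ad}\lambda_\ell^2}$. Asymptotic frameworks: all quantities may depend on an index along which $N\to\infty$, and one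 of the following holds (quantities not listed stay bounded): (I) $a\to\infty$; (II) $a,d\to\infty$; (III) $a,n_{\max}\to\infty$; (IV) $d,n_{\max}\to\infty$; (V) $a,d,n_{\max}\to\infty$. *)

(* Defs.v *)
From HB Require Import structures.
From mathcomp Require Import all_boot all_order all_algebra.
From mathcomp Require Import all_classical all_reals all_analysis.
Set Implicit Arguments. Unset Strict Implicit. Unset Printing Implicit Defensive.
Import Order.TTheory GRing.Theory Num.Theory.
Import numFieldNormedType.Exports.
Local Open Scope classical_set_scope.
Local Open Scope ring_scope.

Section Defs.
Context {R : realType}.

(* Kronecker product A (x) B, indexed via MathComp's mxvec_index convention:
   entry (mxvec_index i1 i2, mxvec_index j1 j2) = A i1 j1 * B i2 j2. *)
Definition kron m1 n1 m2 n2 (A : 'M[R]_(m1, n1)) (B : 'M[R]_(m2, n2))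
  : 'M[R]_(m1 * m2, n1 * n2) :=
  \matrix_(i, j)
    (let ii := enum_val (cast_ord (esym (mxvec_cast m1 m2)) i) in
     let jj := enum_val (cast_ord (esym (mxvec_cast n1 n2)) j) in
     A ii.1 jj.1 * B ii.2 jj.2).

Definition sym_idem_nz n (A : 'M[R]_n) : Prop :=
  A^T = A /\ A *m A = A /\ A != 0.

Definition posdef n (S : 'M[R]_n) : Prop :=
  S^T = S /\ forall x : 'cV[R]_n, x != 0 -> 0 < (x^T *m S *m x) 0 0.

Definition Ntot a (n : 'I_a -> nat) : nat := (\sum_(i < a) n i)%N.
Definition nmax a (n : 'I_a -> nat) : nat := (\max_(i < a) n i)%N.

(* V_N = (+)_i (N / n_i) Sigma = diag(N/n_1,...,N/n_a) (x) Sigma *)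
Definition VN a d (n : 'I_a -> nat) (Sigma : 'M[R]_d) : 'M[R]_(a * d) :=
  kron (diag_mx (\row_i ((Ntot n)%:R / (n i)%:R))) Sigma.

Definition Tmat a d (TW : 'M[R]_a) (TS : 'M[R]_d) : 'M[R]_(a * d) := kron TW TS.

(* stacked mean vector (mu_1', ..., mu_a')' ; row i of Mu is mu_i' *)
Definition stack_mu a d (Mu : 'M[R]_(a, d)) : 'cV[R]_(a * d) := (mxvec Mu)^T.

Definition fP m (T V : 'M[R]_m) : R :=
  (\tr ((T *m V) ^+ 2)) ^+ 3 / (\tr ((T *m V) ^+ 3)) ^+ 2.

(* beta_1 = lambda_1 / sqrt(sum lambda_l^2), for lam = eigenvalues sorted
   decreasingly (so lambda_1 is the head) *)
Definition beta1 (lam : seq R) : R :=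
  head 0 lam / Num.sqrt (\sum_(x <- lam) x ^+ 2).

(* unnormalised chi-squared density with real degrees of freedom f > 0 *)
Definition chi2_fun (f : R) (t : R) : R :=
  if 0 < t then powR t (f / 2 - 1) * expR (- t / 2) else 0.

Definition chi2_cdf (f : R) (x : R) : R :=
  fine (\int[lebesgue_measure]_(t in `]-oo, x]) (chi2_fun f t)%:E)
  / fine (\int[lebesgue_measure]_(t in [set: R]) (chi2_fun f t)%:E).

(* CDF of K_f = (chi^2_f - f)/sqrt(2 f) *)
Definition Kf_cdf (f : R) (x : R) : R := chi2_cdf f (f + x * Num.sqrt (2 * f)).

Definition std_normal_cdf (x : R) : R := fine (normal_prob 0 1 `]-oo, x]).

Definition cvg_in_dist (F : nat -> R -> R) (G : R -> R) : Prop :=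
  forall x : R, {for x, continuous G} -> (fun k => F k x) @ \oo --> G x.

End Defs.

Definition to_infty (u : nat -> nat) : Prop :=
  forall M : nat, \forall k \near \oo, (M <= u k)%N.
Definition bounded_seq (u : nat -> nat) : Prop :=
  exists M : nat, forall k, (u k <= M)%N.

Definition asymp_framework (a d : nat -> nat) (n : forall k, 'I_(a k) -> nat)
  : Prop :=
  let N := fun k => Ntot (n k) in
  let nm := fun k => nmax (n k) in
  to_infty N /\
  (   (to_infty a /\ bounded_seq d /\ bounded_seq nm)
   \/ (to_infty a /\ to_infty d /\ bounded_seq nm)
   \/ (to_infty a /\ bounded_seq d /\ to_infty nm)
   \/ (bounded_seq a /\ to_infty d /\ to_infty nm)
   \/ (to_infty a /\ to_infty d /\ to_infty nm)).
Arguments asymp_framework : clear implicits.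

(* Main.v *)
(* With S_k the sum of the k-th powers of the eigenvalues, f_P = S_2^3 / S_3^2, since
   T idempotent makes the traces of powers of T V_N power sums of the eigenvalues of
   T V_N T.  These eigenvalues are nonnegative, so lambda_1^3 <= S_3 <= lambda_1 S_2,
   that is beta_1^-2 <= f_P <= beta_1^-6: beta_1 -> 0 forces f_P -> oo and beta_1 -> 1
   forces f_P -> 1.  The distribution function of K_f is then studied directly on its
   density by dominated convergence.  For f -> oo write f = 2 m^2; after an affine
   change of variable the density at s is, up to a constant factor,
   exp ((m^2 - 1) ln (1 + s / m) - m s), which tends to exp (- s^2 / 2) and is dominated
   by exp (1 - s / 4) for s >= 0 and by exp (1 - s^2 / 4) for s < 0. *)
Require Import Defs.
From HB Require Import structures.
From mathcomp Require Import all_boot all_order all_algebra.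
From mathcomp Require Import all_classical all_reals all_analysis.
From mathcomp Require Import measurable_realfun ring lra.
Import Order.TTheory GRing.Theory Num.Theory.
Import numFieldNormedType.Exports.
Local Open Scope classical_set_scope.
Local Open Scope ring_scope.

Set Implicit Arguments. Unset Strict Implicit. Unset Printing Implicit Defensive.

(** * Traces and eigenvalues *)

Lemma expr_lblock_mx (F : fieldType) m n (A : 'M[F]_m) (C : 'M[F]_(n, m))
    (D : 'M[F]_n) k :
  exists Ck, (block_mx A 0 C D) ^+ k = block_mx (A ^+ k) 0 Ck (D ^+ k).
Proof.
elim: k => [|k [Ck IH]]; first by exists 0; rewrite !expr0 -scalar_mx_block.
exists (C *m A ^+ k + D *m Ck).
rewrite exprS IH -[_ * _]/(_ *m _) mulmx_block.
by rewrite !mul0mx !mulmx0 !addr0 add0r !exprS.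
Qed.

Lemma exprmx_conj (F : fieldType) n (E A : 'M[F]_n) k : E \in unitmx ->
  (E *m A *m invmx E) ^+ k = E *m A ^+ k *m invmx E.
Proof.
move=> uE; elim: k => [|k IH]; first by rewrite !expr0 mulmx1 mulmxV.
by rewrite !exprS IH -![_ * _]/(_ *m _) !mulmxA mulmxKV.
Qed.

Lemma char_poly_conj (F : fieldType) n (E A : 'M[F]_n) : E \in unitmx ->
  char_poly (E *m A *m invmx E) = char_poly A.
Proof.
move=> uE; rewrite /char_poly /char_poly_mx.
have uE' : map_mx polyC E *m map_mx polyC (invmx E) = 1%:M.
  by rewrite -map_mxM mulmxV // map_scalar_mx rmorph1.
have -> : 'X%:M - map_mx polyC (E *m A *m invmx E) =
   map_mx polyC E *m ('X%:M - map_mx polyC A) *m map_mx polyC (invmx E).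
  rewrite mulmxBr mulmxBl !map_mxM; congr (_ - _).
  by rewrite scalar_mxC -mulmxA uE' mulmx1.
by rewrite !det_mulmx mulrAC -det_mulmx uE' det1 mul1r.
Qed.

Lemma char_poly_lblock (F : fieldType) m n (A : 'M[F]_m) (C : 'M[F]_(n, m))
    (D : 'M[F]_n) :
  char_poly (block_mx A 0 C D) = char_poly A * char_poly D.
Proof.
rewrite /char_poly /char_poly_mx map_block_mx map_mx0 scalar_mx_block.
by rewrite opp_block_mx add_block_mx oppr0 addr0 det_lblock.
Qed.

(** Induction on the list of roots: a change of basis puts an eigenvector for [x] first, which makes
    the matrix block lower triangular with corner [x]. The other diagonal block has the remaining
    roots, and traces of powers see only the diagonal blocks. No diagonalisation is involved, so any
    field over which the characteristic polynomial splits will do. *)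
Lemma mxtrace_exp_char_poly (F : fieldType) n (A : 'M[F]_n) (s : seq F) k :
  char_poly A = \prod_(x <- s) ('X - x%:P) ->
  \tr (A ^+ k) = \sum_(x <- s) x ^+ k.
Proof.
elim: s n A => [|x s IH] n A cA.
  have := size_char_poly A; rewrite cA big_nil size_poly1 => -[n0].
  by rewrite big_nil /mxtrace; case: n / n0 A cA => A _; rewrite big_ord0.
(* Comparing degrees identifies the dimension with [1 + size s], the shape that the block
   decomposition requires. *)
have := size_char_poly A; rewrite cA size_prod_XsubC /= => -[sn].
case: n / sn A cA => A cA.
have : eigenvalue A x.
  by rewrite eigenvalue_root_char cA big_cons rootM root_XsubC eqxx.
case/eigenvalueP => v vA v0.
have rv : \rank v = 1%N.
  by apply/eqP; rewrite eqn_leq rank_leq_row lt0n mxrank_eq0.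
(* [E] is a basis whose first row is proportional to [v]; in this basis the eigenvector becomes
   [e0]. *)
set E := row_ebase v.
have uE : E \in unitmx := row_ebase_unit v.
pose e0 : 'rV[F]_(1 + size s) := pid_mx 1.
have [c c0 vE] : exists2 c, c != 0 & v = c *: (e0 *m E).
  have := mulmx_ebase v; rewrite rv => vE.
  exists (col_ebase v 0 0); last first.
    by rewrite -{1}vE {1}[col_ebase v]mx11_scalar mul_scalar_mx -scalemxAl.
  have := col_ebase_unit v; rewrite {1}[col_ebase v]mx11_scalar unitmxE det_scalar1.
  by rewrite unitfE.
have e0A : e0 *m (E *m A *m invmx E) = x *: e0.
  apply: (scalerI c0); rewrite !mulmxA scalemxAl -[c *: _]scale1r.
  rewrite scale1r scalemxAl -vE vA vE -!scalemxAl scalerA mulrC -scalerA.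
  by rewrite mulmxK.
pose B : 'M[F]_(1 + size s) := E *m A *m invmx E.
have {}e0A : @mulmx F 1 (1 + size s) (1 + size s) e0 B = x *: e0 := e0A.
have e0E : e0 = row_mx 1%:M 0.
  by rewrite /e0 pid_mx_row.
have [C [D BE]] : exists C D, B = block_mx x%:M 0 C D.
  exists (dlsubmx B), (drsubmx B); rewrite -[LHS]submxK.
  move: e0A; rewrite -{1}[B]submxK e0E mul_row_block !mul1mx !mul0mx !addr0.
  rewrite scale_row_mx scaler0 scalemx1 => /eq_row_mx [-> ->] //.
have cB : char_poly B = char_poly A := char_poly_conj A uE.
have cD : char_poly D = \prod_(x <- s) ('X - x%:P).
  (* The factor ['X - x%:P] contributed by the corner is cancelled from both characteristic
     polynomials. *)
  apply: (mulfI (negbT (polyXsubC_eq0 x))).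
  move: cB; rewrite BE char_poly_lblock cA big_cons => <-; congr (_ * _).
  by rewrite /char_poly /char_poly_mx map_scalar_mx -raddfB det_scalar1.
have -> : \tr (A ^+ k) = \tr (B ^+ k).
  by rewrite exprmx_conj // mxtrace_mulC mulmxA mulVmx // mul1mx.
rewrite BE; have [Ck ->] := expr_lblock_mx x%:M C D k.
rewrite mxtrace_block (IH _ D cD) big_cons; congr (_ + _).
by rewrite -rmorphXn mxtrace_scalar.
Qed.

(** * Kronecker products and positive definiteness of [VN] *)

Section kron.
Context {R : realType}.

Lemma kronE m1 n1 m2 n2 (A : 'M[R]_(m1, n1)) (B : 'M[R]_(m2, n2)) i1 i2 j1 j2 :
  kron A B (mxvec_index i1 i2) (mxvec_index j1 j2) = A i1 j1 * B i2 j2.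
Proof. by rewrite mxE !cast_ordK !enum_rankK. Qed.

Lemma sum_mxvec_index m n (F : 'I_(m * n) -> R) :
  \sum_i F i = \sum_i \sum_j F (mxvec_index i j).
Proof.
rewrite (reindex _ (curry_mxvec_bij _ _)) /=.
by rewrite pair_bigA; apply: eq_bigr => -[].
Qed.

Lemma mul_kron m1 n1 m2 n2 p1 p2 (A : 'M[R]_(m1, n1)) (B : 'M[R]_(m2, n2))
    (C : 'M[R]_(n1, p1)) (D : 'M[R]_(n2, p2)) :
  kron A B *m kron C D = kron (A *m C) (B *m D).
Proof.
apply/matrixP => i j; case/mxvec_indexP: i => i1 i2.
case/mxvec_indexP: j => j1 j2; rewrite kronE !mxE sum_mxvec_index big_distrlr /=.
by apply: eq_bigr => k1 _; apply: eq_bigr => k2 _; rewrite !kronE mulrACA.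
Qed.

Lemma tr_kron m1 n1 m2 n2 (A : 'M[R]_(m1, n1)) (B : 'M[R]_(m2, n2)) :
  (kron A B)^T = kron A^T B^T.
Proof.
apply/matrixP => i j; case/mxvec_indexP: i => i1 i2.
by case/mxvec_indexP: j => j1 j2; rewrite mxE !kronE !mxE.
Qed.

Lemma sym_idem_nz_kron a d (A : 'M[R]_a) (B : 'M[R]_d) :
  sym_idem_nz A -> sym_idem_nz B -> sym_idem_nz (kron A B).
Proof.
move=> [sA [iA /matrix0Pn [i1 [j1 nA]]]] [sB [iB /matrix0Pn [i2 [j2 nB]]]].
split; first by rewrite tr_kron sA sB.
split; first by rewrite mul_kron iA iB.
apply/matrix0Pn; exists (mxvec_index i1 i2), (mxvec_index j1 j2).
by rewrite kronE mulf_neq0.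
Qed.

Lemma quadform_diag_kron a d (D : 'rV[R]_a) (S : 'M[R]_d) (x : 'cV[R]_(a * d)) :
  (x^T *m kron (diag_mx D) S *m x) 0 0 =
  \sum_i D 0 i * ((\col_j x (mxvec_index i j) 0)^T *m S
                   *m (\col_j x (mxvec_index i j) 0)) 0 0.
Proof.
rewrite mxE sum_mxvec_index; apply: eq_bigr => i _.
rewrite mxE big_distrr /=; apply: eq_bigr => j _.
rewrite !mxE mulrA; congr (_ * _).
rewrite sum_mxvec_index (bigD1 i) //= [X in _ + X]big1 ?addr0 => [|i' ne]; last first.
  rewrite big1 // => j' _; rewrite kronE !mxE (negPf ne) mulr0n.
  by rewrite mul0r mulr0.
rewrite big_distrr /=; apply: eq_bigr => j' _.
by rewrite kronE !mxE eqxx mulr1n mulrCA.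
Qed.

(** The quadratic form is a sum over groups of forms in [S] with weights [N / n_i]. A nonzero vector
    has a nonzero block, whose term is positive, and the other terms are nonnegative. *)
Lemma posdef_VN a d (n : 'I_a -> nat) (S : 'M[R]_d) :
  (forall i, (0 < n i)%N) -> posdef S -> posdef (VN n S).
Proof.
move=> n0 [sS pS]; split; first by rewrite /VN tr_kron tr_diag_mx sS.
move=> x /cV0Pn [k]; case/mxvec_indexP: k => i j xij.
have N0 : 0 < (Ntot n)%:R :> R.
  by rewrite ltr0n /Ntot (bigD1 i) //= addn_gt0 n0.
rewrite /VN quadform_diag_kron (bigD1 i) //= ltr_wpDr //.
  apply: sumr_ge0 => i' _; rewrite mxE mulr_ge0 ?divr_ge0 //.
  set y := \col_j _; have [->|y0] := eqVneq y 0; last exact/ltW/pS.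
  by rewrite mulmx0 mxE.
rewrite mxE; apply: mulr_gt0; first by rewrite divr_gt0 // ltr0n.
by apply: pS; apply/cV0Pn; exists j; rewrite mxE.
Qed.

End kron.

(** * Eigenvalues of [T *m V *m T] for an orthogonal projection [T] *)

Section compression.
Context {R : realType}.
Variables (m : nat) (T V : 'M[R]_m).
Hypotheses (hT : sym_idem_nz T) (hV : posdef V).
Variable lam : seq R.
Hypothesis hlam : char_poly (T *m V *m T) = \prod_(x <- lam) ('X - x%:P).

Let quad (x : 'cV[R]_m) : 0 <= (x^T *m V *m x) 0 0.
Proof.
have [->|x0] := eqVneq x 0; last exact/ltW/(proj2 hV).
by rewrite mulmx0 mxE.
Qed.

(** For a left eigenvector [v], the form of [V] at [T *m v^T] equals [x] times the squared norm of
    [v]. *)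
Lemma compression_eigenvalue_ge0 x : x \in lam -> 0 <= x.
Proof.
move=> xl; have : eigenvalue (T *m V *m T) x.
  by rewrite eigenvalue_root_char hlam root_prod_XsubC.
case/eigenvalueP => v vA v0.
have := quad (T *m v^T); rewrite trmx_mul trmxK (proj1 hT) !mulmxA.
rewrite !mulmxA in vA; rewrite vA -scalemxAl.
rewrite mxE pmulr_lge0 // mxE.
have [i vi] := rV0Pn _ v0.
rewrite (bigD1 i) //= !mxE ltr_pwDl //.
  by rewrite -expr2 lt_neqAle sqr_ge0 eq_sym sqrf_eq0 vi.
by apply: sumr_ge0 => j _; rewrite mxE -expr2 sqr_ge0.
Qed.

(** Idempotence merges neighbouring copies of [T], so the power of [T *m V *m T] is that of [T *m V]
    followed by one [T]; cyclicity of the trace moves this [T] to the front, where it is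
    absorbed. *)
Lemma tr_compression_exp k : \tr ((T *m V) ^+ k.+1) = \sum_(x <- lam) x ^+ k.+1.
Proof.
rewrite -(mxtrace_exp_char_poly _ hlam).
have -> : (T *m V *m T) ^+ k.+1 = (T *m V) ^+ k.+1 *m T.
  elim: k => [//|k IH]; rewrite exprS IH [in RHS]exprS -![_ * _]/(_ *m _).
  rewrite !mulmxA; congr (_ *m _).
  rewrite [in RHS]exprS [in LHS]exprS -![_ * _]/(_ *m _) !mulmxA.
  by rewrite -(mulmxA _ T T) (proj1 (proj2 hT)).
rewrite mxtrace_mulC; congr (\tr _).
by rewrite exprS -[_ * _]/(_ *m _) !mulmxA (proj1 (proj2 hT)).
Qed.

(** The sum is the trace, whose diagonal terms are the values of the form of [V] at the columns of
    [T], and some column is nonzero. *)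
Lemma compression_sum_gt0 : 0 < \sum_(x <- lam) x.
Proof.
have -> : \sum_(x <- lam) x = \tr (T *m V *m T).
  by rewrite -[T *m V *m T]expr1 (mxtrace_exp_char_poly _ hlam).
have dE i : (T *m V *m T) i i = ((col i T)^T *m V *m col i T) 0 0.
  rewrite tr_col (proj1 hT) -row_mul [LHS]mxE [RHS]mxE.
  by apply: eq_bigr => j _; rewrite [row _ _ _ _]mxE [col _ _ _ _]mxE.
have [i [j Tij]] := matrix0Pn _ (proj2 (proj2 hT)).
rewrite /mxtrace (bigD1 j) //= ltr_pwDl // ?dE.
  by apply: (proj2 hV); apply/cV0Pn; exists i; rewrite mxE.
by apply: sumr_ge0 => l _; rewrite dE.
Qed.

End compression.

(** With [x] the largest entry, the lower bound comes from [S3 <= x * S2] and the upper one from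
    [x ^+ 3 <= S3]. Positivity of the sum excludes the empty list and forces [x > 0]. *)
Lemma fP_bounds (R : realType) (s : seq R) :
  sorted >=%R s -> (forall x, x \in s -> 0 <= x) -> 0 < \sum_(x <- s) x ->
  let f := (\sum_(x <- s) x ^+ 2) ^+ 3 / (\sum_(x <- s) x ^+ 3) ^+ 2 in
  [/\ 0 < beta1 s, (beta1 s) ^- 2 <= f & f <= (beta1 s) ^- 6].
Proof.
case: s => [|x s] srt s0; first by rewrite big_nil ltxx.
move=> sp.
have mx y : y \in x :: s -> y <= x.
  rewrite inE => /predU1P [->//|ys].
  move: srt; rewrite /= (path_sortedE (rev_trans le_trans)) => /andP [/allP h _].
  exact: h.
have x0 : 0 < x.
  rewrite lt_neqAle s0 ?mem_head // andbT; apply/eqP => x0; move: sp.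
  rewrite big_seq big1 ?ltxx // => y ys; apply/eqP; rewrite eq_le s0 //.
  by rewrite x0 mx.
rewrite /beta1 /=; set S2 := \sum_(y <- x :: s) y ^+ 2; set S3 := \sum_(y <- x :: s) y ^+ 3.
have xS3 : x ^+ 3 <= S3.
  rewrite /S3 big_cons lerDl big_seq; apply: sumr_ge0 => y ys.
  by rewrite exprn_ge0 // s0 // inE ys orbT.
have S3x : S3 <= x * S2.
  rewrite /S3 /S2 big_distrr /= !big_seq; apply: ler_sum => y ys.
  by rewrite exprS ler_wpM2r ?sqr_ge0 // mx.
have S2p : 0 < S2.
  rewrite /S2 big_cons ltr_pwDl ?exprn_gt0 //.
  by apply: sumr_ge0 => y _; rewrite sqr_ge0.
have S3p : 0 < S3 by apply: lt_le_trans xS3; rewrite exprn_gt0.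
have q0 : 0 < Num.sqrt S2 by rewrite sqrtr_gt0.
split; first by rewrite divr_gt0.
- rewrite expr_div_n invf_div sqr_sqrtr ?(ltW S2p) // ler_pdivrMr ?exprn_gt0 //.
  rewrite mulrAC ler_pdivlMr ?exprn_gt0 //.
  rewrite -subr_ge0.
  have -> : S2 ^+ 3 * x ^+ 2 - S2 * S3 ^+ 2 = S2 * ((x * S2) ^+ 2 - S3 ^+ 2) by ring.
  apply: mulr_ge0; first exact: ltW.
  by rewrite subr_ge0 ler_sqr // nnegrE ltW // mulr_gt0.
- rewrite ler_pdivrMr ?exprn_gt0 // expr_div_n invf_div (exprM _ 2 3) sqr_sqrtr ?(ltW S2p) //.
  rewrite mulrAC ler_pdivlMr ?exprn_gt0 // ler_pM2l ?exprn_gt0 //.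
  by rewrite (exprM x 3 2) ler_sqr // nnegrE ltW // exprn_gt0.
Qed.

(** * Logarithmic bounds *)

Section log_bounds.
Context {R : realType}.
Implicit Types (w x y : R).

Lemma is_derive_gt0_nondecreasing (f f' : R -> R) :
  (forall x, 0 < x -> is_derive x 1 f (f' x)) -> (forall x, 0 < x -> 0 <= f' x) ->
  forall x y, 0 < x -> x <= y -> f x <= f y.
Proof.
move=> df f'0 x y x0 xy.
have d z : z \in `]x, y[%R -> is_derive z 1 f (f' z).
  by rewrite in_itv /= => /andP [xz _]; apply: df; exact: lt_trans xz.
apply: (@ger0_derive1_ndecr _ f x y) => //.
- by move=> z /d [].
- move=> z zi; rewrite derive1E; have [_ ->] := d z zi; apply: f'0.
  by move: zi; rewrite in_itv /= => /andP [xz _]; exact: lt_trans xz.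
- apply: derivable_within_continuous => z; rewrite in_itv /= => /andP [xz _].
  by have [] := df z (lt_le_trans x0 xz).
Qed.

(** The function vanishes at 1, so monotonicity gives [ln x <= (x - x^-1) / 2] for [x >= 1] and the
    reverse inequality for [x <= 1]. *)
Lemma nondecreasing_half_subV_ln x y : 0 < x -> x <= y ->
  (x - x^-1) / 2 - ln x <= (y - y^-1) / 2 - ln y.
Proof.
apply: (@is_derive_gt0_nondecreasing (fun x => (x - x^-1) / 2 - ln x)
   (fun x => (1 - x^-1) ^+ 2 / 2)) => w w0; last by rewrite divr_ge0 ?sqr_ge0.
have wn : w != 0 by rewrite gt_eqF.
have dl := is_derive1_ln w0.
have dv := is_deriveV wn (is_derive_id w 1).
apply: is_derive_eq.
rewrite /GRing.scale /=; field; exact: wn.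
Qed.

(** Again the value at 1 is 0: the logarithm lies above its second order Taylor polynomial at 1 to
    the right of 1, and below it to the left. *)
Lemma nondecreasing_ln_sub_taylor2 x y : 0 < x -> x <= y ->
  ln x - (x - 1) + (x - 1) ^+ 2 / 2 <= ln y - (y - 1) + (y - 1) ^+ 2 / 2.
Proof.
apply: (@is_derive_gt0_nondecreasing (fun x => ln x - (x - 1) + (x - 1) ^+ 2 / 2)
   (fun x => (x - 1) ^+ 2 / x)) => w w0; last by rewrite divr_ge0 ?sqr_ge0 // ltW.
have wn : w != 0 by rewrite gt_eqF.
have dl := is_derive1_ln w0.
apply: is_derive_eq.
rewrite /GRing.scale /=; field; exact: wn.
Qed.

End log_bounds.

(** * Standardised chi-squared density: domination and pointwise limit *)

Section std_chi2.
Context {R : realType}.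
Implicit Types (m s x y : R).

(* Up to a constant factor, the density of [(chi^2_f - f) / sqrt (2 f)] at [s],
   where [f = 2 m^2]. *)
Definition std_chi2_fun m s : R :=
  if 0 < m + s then expR ((m ^+ 2 - 1) * ln (1 + s / m) - m * s) else 0.

Lemma std_chi2_fun_ge0 m s : 0 <= std_chi2_fun m s.
Proof. by rewrite /std_chi2_fun; case: ifP => // _; exact: expR_ge0. Qed.

(** With [f = 2 m^2] the mean is [2 m^2] and the standard deviation [2 m], so no square root
    appears; the point of evaluation factors as [2 m^2 (1 + s / m)]. *)
Lemma chi2_fun_std m s : 0 < m ->
  chi2_fun (2 * m ^+ 2) (2 * m ^+ 2 + s * (2 * m)) =
  (2 * m ^+ 2) `^ (m ^+ 2 - 1) * expR (- m ^+ 2) * std_chi2_fun m s.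
Proof.
move=> m0; have mn : m != 0 by rewrite gt_eqF.
have tE : 2 * m ^+ 2 + s * (2 * m) = 2 * m ^+ 2 * (1 + s / m) by field; exact: mn.
have w0 : (0 < 1 + s / m) = (0 < m + s).
  rewrite -(pmulr_rgt0 (1 + s / m) m0); congr (_ < _); field; exact: mn.
have c0 : 0 < 2 * m ^+ 2 by rewrite mulr_gt0 // exprn_gt0.
rewrite /chi2_fun /std_chi2_fun tE pmulr_rgt0 // w0.
case: ifP => ms; last by rewrite mulr0.
have w0' : 0 < 1 + s / m by rewrite w0.
rewrite powRM ?ltW //; have -> : 2 * m ^+ 2 / 2 - 1 = m ^+ 2 - 1 by field.
rewrite -!mulrA; congr (_ * _).
rewrite /powR (gt_eqF w0') -!expRD; congr expR; field; exact: mn.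
Qed.

(** Put [w = 1 + s / m]. For [s >= 0] the bound [(w - w^-1) / 2] on [ln w] leaves linear decay; for
    [s < 0] the Taylor bound leaves Gaussian decay, and the constant 1 absorbs the leftover
    [1 - w]. *)
Lemma std_chi2_fun_le m s : 2 <= m ->
  std_chi2_fun m s <= if 0 <= s then expR (1 - s / 4) else expR (1 - s ^+ 2 / 4).
Proof.
move=> m2; have m0 : 0 < m by lra.
have mn : m != 0 by rewrite gt_eqF.
rewrite /std_chi2_fun; case: ifP => ms; last by case: ifP => _; exact: expR_ge0.
pose w := 1 + s / m.
have sE : s = m * (w - 1) by rewrite /w; field; exact: mn.
have w0 : 0 < w.
  rewrite -(pmulr_rgt0 _ m0); have -> : m * w = m + s by rewrite sE; ring.
  exact: ms.
have m1 : 0 <= m ^+ 2 - 1 by nra.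
have [s0|s0] := leP 0 s; rewrite ler_expR -/w [in X in _ - m * X]sE [in leRHS]sE.
- have w1 : 1 <= w by rewrite /w lerDl divr_ge0 // ltW.
  have := @nondecreasing_half_subV_ln R 1 w ltr01 w1.
  rewrite ln1 invr1 !subrr mul0r subr0 subr_ge0 => h.
  apply: (@le_trans _ _ ((m ^+ 2 - 1) * ((w - w^-1) / 2) - m * (m * (w - 1)))).
    by rewrite lerD2r ler_wpM2l.
  have -> : (m ^+ 2 - 1) * ((w - w^-1) / 2) - m * (m * (w - 1))
    = - (m ^+ 2 - 1) * (w - 1) ^+ 2 / (2 * w) - (w - 1).
    by field; rewrite gt_eqF.
  rewrite -subr_ge0.
  have -> : 1 - m * (w - 1) / 4 -
      (- (m ^+ 2 - 1) * (w - 1) ^+ 2 / (2 * w) - (w - 1)) =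
     (4 * w ^+ 2 - m * (w - 1) * w + 2 * (m ^+ 2 - 1) * (w - 1) ^+ 2) / (4 * w).
    by field; rewrite gt_eqF.
  rewrite divr_ge0 //; last by rewrite mulr_ge0 // ltW.
  pose v := w - 1; have -> : w = 1 + v by rewrite /v; ring.
  have v0 : 0 <= v by rewrite /v subr_ge0.
  have -> : 1 + v - 1 = v by ring.
  (* The numerator is [4 + 8 v - m v + (2 m^2 - m + 2) v^2]. The square of [m v - 1] controls the
     term [- m v], and the products with [v ^+ 2] control [- m v^2]. *)
  have : 0 <= (m * v - 1) ^+ 2 by rewrite sqr_ge0.
  have : 0 <= (m ^+ 2 - 4) * v ^+ 2 by apply: mulr_ge0; [nra|exact: sqr_ge0].
  have : 0 <= (m - 2) * v ^+ 2 by apply: mulr_ge0; [lra|exact: sqr_ge0].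
  have : 0 <= (m - 2) ^+ 2 * v ^+ 2 by apply: mulr_ge0; exact: sqr_ge0.
  nra.
- have w1 : w <= 1 by rewrite /w gerDl mulr_le0_ge0 ?invr_ge0 ?ltW.
  have := @nondecreasing_ln_sub_taylor2 R w 1 w0 w1.
  rewrite ln1 !subrr expr0n /= mul0r addr0 => h.
  have {}h : ln w <= (w - 1) - (w - 1) ^+ 2 / 2 by lra.
  apply: (@le_trans _ _ ((m ^+ 2 - 1) * ((w - 1) - (w - 1) ^+ 2 / 2)
                         - m * (m * (w - 1)))).
    by rewrite lerD2r ler_wpM2l.
  have : 0 <= (m ^+ 2 - 4) * (w - 1) ^+ 2 by apply: mulr_ge0; [nra|exact: sqr_ge0].
  nra.
Qed.


(** The exponent is [A k - ln (w k)]. The two logarithmic bounds squeeze [A k] between [- s^2 / 2]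
    and [- s^2 / (2 w k)], in an order that depends on the sign of [s], while [w k] tends to 1. *)
Lemma cvg_std_chi2_fun (m : nat -> R) s : m @ \oo --> +oo%R ->
  (fun k => std_chi2_fun (m k) s) @ \oo --> expR (- s ^+ 2 / 2).
Proof.
move=> moo; pose w k := 1 + s / m k.
have w1 : w @ \oo --> (1 : R).
  rewrite -[X in _ --> X]addr0 -[X in 1 + X](mulr0 s).
  apply: cvgD; first exact: cvg_cst.
  by apply: cvgMr; apply/gtr0_cvgV0 => //; move/cvgryPgt: moo; exact.
(* Beyond [|s| + 1] both [m k] and [m k + s] are positive, so the default value 0 of the density is
   not taken. *)
have big : \forall k \near \oo, `|s| + 1 < m k by move/cvgryPgt: moo; exact.
have ev : \forall k \near \oo, [/\ 0 < m k, 0 < w k, 0 < m k + s & s = m k * (w k - 1)].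
  near=> k; have b : `|s| + 1 < m k by near: k.
  have m0 : 0 < m k by apply: le_lt_trans b; rewrite addr_ge0.
  have ms : 0 < m k + s.
    have := ler_norm (- s); rewrite normrN => ?; lra.
  have sE : s = m k * (w k - 1) by rewrite /w; field; rewrite gt_eqF.
  split => //; rewrite -(pmulr_rgt0 _ m0).
  by have -> : m k * w k = m k + s by rewrite [in RHS]sE; ring.
pose A k := m k ^+ 2 * (ln (w k) - (w k - 1)).
have hA : A @ \oo --> - s ^+ 2 / 2.
  have B1 : (fun k => - s ^+ 2 / (2 * w k)) @ \oo --> - s ^+ 2 / 2.
    have -> : - s ^+ 2 / 2 = - s ^+ 2 / (2 * 1) by rewrite mulr1.
    apply: cvgMr; apply: cvgV; first by rewrite mulr1.
    exact: cvgMr.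
  have B0 : (fun k : nat => - s ^+ 2 / 2) @ \oo --> - s ^+ 2 / 2 by exact: cvg_cst.
  have L1 k : 0 < w k -> s = m k * (w k - 1) -> 1 <= w k ->
      - s ^+ 2 / 2 <= A k <= - s ^+ 2 / (2 * w k).
    move=> w0 sE w1k; rewrite /A {1 2}sE.
    have h1 := nondecreasing_half_subV_ln ltr01 w1k.
    have h2 := nondecreasing_ln_sub_taylor2 ltr01 w1k.
    rewrite ln1 invr1 !subrr mul0r subr0 subr_ge0 in h1.
    rewrite ln1 !subrr expr0n /= mul0r addr0 in h2.
    have m20 := sqr_ge0 (m k).
    have -> : - (m k * (w k - 1)) ^+ 2 / 2 = m k ^+ 2 * (- (w k - 1) ^+ 2 / 2) by field.
    have -> : - (m k * (w k - 1)) ^+ 2 / (2 * w k) =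
        m k ^+ 2 * ((w k - (w k)^-1) / 2 - (w k - 1)).
      by field; rewrite gt_eqF.
    by apply/andP; split; rewrite ler_wpM2l //; lra.
  have L2 k : 0 < w k -> s = m k * (w k - 1) -> w k <= 1 ->
      - s ^+ 2 / (2 * w k) <= A k <= - s ^+ 2 / 2.
    move=> w0 sE w1k; rewrite /A {1 2}sE.
    have h1 := nondecreasing_half_subV_ln w0 w1k.
    have h2 := nondecreasing_ln_sub_taylor2 w0 w1k.
    rewrite ln1 invr1 !subrr mul0r subr0 subr_le0 in h1.
    rewrite ln1 !subrr expr0n /= mul0r addr0 in h2.
    have m20 := sqr_ge0 (m k).
    have -> : - (m k * (w k - 1)) ^+ 2 / 2 = m k ^+ 2 * (- (w k - 1) ^+ 2 / 2) by field.
    have -> : - (m k * (w k - 1)) ^+ 2 / (2 * w k) =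
        m k ^+ 2 * ((w k - (w k)^-1) / 2 - (w k - 1)).
      by field; rewrite gt_eqF.
    by apply/andP; split; rewrite ler_wpM2l //; lra.
  have [s0|s0] := leP 0 s.
  - apply: squeeze_cvgr B0 B1; near=> k.
    have [m0 w0 _ sE] : [/\ 0 < m k, 0 < w k, 0 < m k + s & s = m k * (w k - 1)]
      by near: k.
    by apply: L1 => //; rewrite /w lerDl divr_ge0 // ltW.
  - apply: squeeze_cvgr B1 B0; near=> k.
    have [m0 w0 _ sE] : [/\ 0 < m k, 0 < w k, 0 < m k + s & s = m k * (w k - 1)]
      by near: k.
    by apply: L2 => //; rewrite /w gerDl mulr_le0_ge0 ?invr_ge0 // ltW.
have hl : (fun k => ln (w k)) @ \oo --> (0 : R).
  rewrite -ln1; apply: (cvg_comp _ _ w1); exact: continuous_ln.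
apply: (@cvg_trans _ ((fun k => expR (A k - ln (w k))) @ \oo)).
  apply: near_eq_cvg; near=> k.
  have [m0 w0 ms sE] : [/\ 0 < m k, 0 < w k, 0 < m k + s & s = m k * (w k - 1)]
    by near: k.
  rewrite /std_chi2_fun ms -/(w k) /A; congr expR.
  by rewrite [in RHS]sE; ring.
apply: continuous_cvg; first exact: continuous_expR.
by rewrite -[X in _ --> X]subr0; exact: cvgB.
Unshelve. all: by end_near. Qed.

End std_chi2.

(** * Affine change of variable *)

Section affine.
Context {R : realType}.
Local Notation mu := (@lebesgue_measure R).

Lemma measurable_affine (b c : R) :
  measurable_fun [set: R] ((fun s : R => b + s * c) : R -> measurableTypeR R).
Proof.
apply: continuous_measurable_fun => s; apply: cvgD; first exact: cvg_cst.
by apply: cvgMl; exact: cvg_id.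
Qed.

(** By uniqueness of Lebesgue measure it is enough to compare half-open intervals; the preimage of
    one has its length divided by [c]. *)
Lemma lebesgue_measure_affine (b : R) (c : {posnum R}) (A : set R) :
  measurable A ->
  mu A = (c%:num%:E * pushforward mu
    ((fun s : R => b + s * c%:num)%R : R -> measurableTypeR R) A)%E.
Proof.
move=> mA; set phi := (fun s : R => b + s * c%:num) : R -> measurableTypeR R.
apply: (lebesgue_measure_unique (mu := mscale (c%:num)%:nng (pushforward mu phi))) => //.
  exact: measurable_affine.
move=> mphi _ [[x y]] _ <- /=.
rewrite /mscale /pushforward /=.
rewrite [X in (_ * mu X)%E](_ : _ =
    `](x - b) / c%:num, (y - b) / c%:num]%classic); last first.
  apply/seteqP; split => s; rewrite /phi /= !in_itv /= ltr_pdivrMr // ler_pdivlMr //;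
  by rewrite ltrBlDl lerBrDl.
rewrite !lebesgue_measure_itv /= !lte_fin ltr_pM2r ?invr_gt0 // ltrD2r.
case: ifP => _; last by rewrite mule0.
rewrite -!EFinD -EFinM; congr EFin; field; exact: lt0r_neq0.
Qed.

Lemma ge0_integral_affine (b c : R) (D : set R) (g : R -> R) : 0 < c ->
  measurable D -> measurable_fun [set: R] g -> (forall t, 0 <= g t) ->
  (\int[mu]_(t in D) (g t)%:E =
   c%:E * \int[mu]_(s in (fun s => b + s * c)%R @^-1` D) (g (b + s * c)%R)%:E)%E.
Proof.
move=> c0 mD mg g0; pose cp := PosNum c0.
set phi := (fun s : R => b + s * c) : R -> measurableTypeR R.
have mgD : measurable_fun D (EFin \o g).
  by apply/measurable_EFinP; exact: measurable_funTS.
have mphi : measurable_fun [set: R] phi := @measurable_affine b c.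
transitivity (c%:E * \int[pushforward mu phi]_(t in D) (g t)%:E)%E; last first.
  congr (_ * _)%E.
  apply: (@ge0_integral_pushforward _ _ (measurableTypeR R) (measurableTypeR R) R
            phi mphi mu D (EFin \o g) mD mgD).
  by move=> x _; rewrite lee_fin.
pose nu : {measure set (measurableTypeR R) -> \bar R} :=
  measure_function_pushforward__canonical__measure_function_Measure mu mphi.
rewrite -(@ge0_integral_mscale _ (measurableTypeR R) R nu D mD (cp%:num)%:nng) //.
  by apply: eq_measure_integral => A mA _; exact: (lebesgue_measure_affine b cp mA).
by move=> x _; rewrite lee_fin.
Qed.

End affine.

(** * Many degrees of freedom *)

Section chi2_large_f.
Context {R : realType}.
Local Notation mu := (@lebesgue_measure R).

Lemma chi2_fun_ge0 (f t : R) : 0 <= chi2_fun f t.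
Proof.
by rewrite /chi2_fun; case: ifP => // _; rewrite mulr_ge0 ?powR_ge0 ?expR_ge0.
Qed.

Lemma measurable_chi2_fun (f : R) : measurable_fun [set: R] (chi2_fun f).
Proof.
apply: measurable_fun_ifT => //; first exact: measurable_fun_ltr.
apply: measurable_funM; first exact: measurable_powR.
by apply: measurableT_comp => //; apply: measurable_funM.
Qed.

Lemma measurable_std_chi2_fun (m : R) : measurable_fun [set: R] (std_chi2_fun m).
Proof.
apply: measurable_fun_ifT => //.
  by apply: measurable_fun_ltr => //; exact: measurable_funD.
apply: measurableT_comp => //; apply: measurable_funB; last exact: measurable_funM.
apply: measurable_funM => //; apply: measurableT_comp; first exact: measurable_ln.
by apply: measurable_funD => //; exact: measurable_funM.
Qed.

(** The two one-sided bounds are added and expressed through probability densities, whose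
    integrability is known. The Gaussian has standard deviation 2, so its decay [exp (- s^2 / 8)] is
    weaker than the available [exp (- s^2 / 4)]. *)
Definition std_chi2_dom (s : R) : R :=
  expR 1 * 4 * exponential_pdf 4^-1 s + expR 1 / normal_peak 2 * normal_pdf 0 2 s.

Lemma std_chi2_fun_le_dom (m s : R) : 2 <= m -> std_chi2_fun m s <= std_chi2_dom s.
Proof.
move=> m2; apply: (le_trans (std_chi2_fun_le s m2)); rewrite /std_chi2_dom.
have two0 : (2 : R) != 0 by rewrite pnatr_eq0.
have p0 : 0 < normal_peak (2 : R) by exact: normal_peak_gt0.
have [s0|s0] := leP 0 s.
- rewrite exponential_pdfE // ler_wpDr //.
    by rewrite mulr_ge0 ?normal_pdf_ge0 // divr_ge0 ?expR_ge0 // ltW.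
  rewrite expRD -mulrA ler_pM2l ?expR_gt0 // mulrA mulfV // mul1r.
  by rewrite le_eqVlt; apply/orP; left; apply/eqP; congr expR; field.
- rewrite lt0_exponential_pdf // mulr0 add0r normal_pdfE // mulrA mulfVK ?gt_eqF //.
  rewrite /normal_fun -expRD ler_expR subr0.
  have -> : (2 : R) ^+ 2 *+ 2 = 8 by rewrite -mulr_natr; ring.
  have := sqr_ge0 s; lra.
Qed.

Lemma integrable_std_chi2_dom : mu.-integrable [set: R] (EFin \o std_chi2_dom).
Proof.
have -> : EFin \o std_chi2_dom =
  ((fun s => ((expR 1 * 4)%:E * (exponential_pdf 4^-1 s)%:E)%E) \+
  (fun s => ((expR 1 / normal_peak 2)%:E * (normal_pdf 0 2 s)%:E)%E))%E.
  by apply/funext => s.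
apply: integrableD => //; apply: integrableZl => //.
  by apply: integrable_exponential_pdf; rewrite invr_gt0.
exact: integrable_normal_pdf.
Qed.

Lemma std_chi2_fun_dominated_convergence (m : nat -> R) (D : set R) :
  measurable D -> (forall k, 2 <= m k) -> m @ \oo --> +oo%R ->
  let gau s := expR (- s ^+ 2 / 2) in
  mu.-integrable D (EFin \o gau) /\
  (fun k => \int[mu]_(s in D) (std_chi2_fun (m k) s)%:E)%E @ \oo
    --> (\int[mu]_(s in D) (gau s)%:E)%E.
Proof.
move=> mD m2 moo gau.
have mgau : measurable_fun [set: R] gau.
  apply: measurableT_comp => //; apply: measurable_funM => //.
  by apply: measurableT_comp => //; exact: measurable_funX.
have [||||| ? _ ?] := @dominated_convergence _ _ R mu D mD
  (fun k s => (std_chi2_fun (m k) s)%:E) (EFin \o gau) (EFin \o std_chi2_dom) => //.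
- move=> k; apply/measurable_EFinP; apply: measurable_funTS.
  exact: measurable_std_chi2_fun.
- by apply/measurable_EFinP; exact: measurable_funTS.
- apply: aeW => s _; apply/fine_cvgP; split; first by near=> k.
  exact: cvg_std_chi2_fun.
- by apply: (integrableS measurableT) => //; exact: integrable_std_chi2_dom.
- apply: aeW => s k _ /=; rewrite lee_fin ger0_norm ?std_chi2_fun_ge0 //.
  exact: std_chi2_fun_le_dom.
Unshelve. all: by end_near. Qed.

Lemma integrable_std_chi2_fun (m : R) (D : set R) : measurable D -> 2 <= m ->
  mu.-integrable D (EFin \o std_chi2_fun m).
Proof.
move=> mD m2; apply: (@le_integrable _ _ _ mu _ mD _ (EFin \o std_chi2_dom)).
- apply/measurable_EFinP; apply: measurable_funTS; exact: measurable_std_chi2_fun.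
- move=> s _ /=; rewrite lee_fin ger0_norm ?std_chi2_fun_ge0 //.
  by apply: (le_trans (std_chi2_fun_le_dom s m2)); exact: ler_norm.
- by apply: (integrableS measurableT) => //; exact: integrable_std_chi2_dom.
Qed.

(** Standardising multiplies numerator and denominator by the same constant [2 * m * K], which
    cancels. *)
Lemma Kf_cdf_std (m x : R) : 2 <= m ->
  Kf_cdf (2 * m ^+ 2) x =
  fine (\int[mu]_(s in `]-oo, x]) (std_chi2_fun m s)%:E) /
  fine (\int[mu]_(s in [set: R]) (std_chi2_fun m s)%:E).
Proof.
move=> m2; have m0 : 0 < m by lra.
have c0 : 0 < 2 * m by lra.
pose K := (2 * m ^+ 2) `^ (m ^+ 2 - 1) * expR (- m ^+ 2).
have K0 : 0 < K by rewrite mulr_gt0 ?expR_gt0 // powR_gt0 // mulr_gt0 // exprn_gt0.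
have sq : Num.sqrt (2 * (2 * m ^+ 2)) = 2 * m.
  have -> : 2 * (2 * m ^+ 2) = (2 * m) ^+ 2 by ring.
  by rewrite sqrtr_sqr ger0_norm // ltW.
have E (D D' : set R) : measurable D -> measurable D' ->
    (fun s => 2 * m ^+ 2 + s * (2 * m)) @^-1` D = D' ->
    fine (\int[mu]_(t in D) (chi2_fun (2 * m ^+ 2) t)%:E) =
    (2 * m * K) * fine (\int[mu]_(s in D') (std_chi2_fun m s)%:E).
  move=> mD mD' DD'.
  rewrite (@ge0_integral_affine R (2 * m ^+ 2) _ D _ c0 mD (measurable_chi2_fun _)
     (chi2_fun_ge0 _)) DD'.
  under eq_integral do rewrite chi2_fun_std // EFinM.
  rewrite integralZl //; last exact: integrable_std_chi2_fun.
  by rewrite muleA -EFinM fineM // integrable_fin_num //; exact: integrable_std_chi2_fun.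
rewrite /Kf_cdf /chi2_cdf sq (E _ `]-oo, x]%classic) //; last first.
  by apply/seteqP; split => s /=; rewrite !in_itv /= lerD2l ler_pM2r.
rewrite (E _ [set: R]) // -mulf_div divff ?mul1r //.
by rewrite mulf_neq0 // gt_eqF.
Qed.

Lemma std_normal_cdfE (x : R) :
  let gau s := expR (- s ^+ 2 / 2) in
  0 < fine (\int[mu]_(s in [set: R]) (gau s)%:E) /\
  std_normal_cdf x = fine (\int[mu]_(s in `]-oo, x]) (gau s)%:E) /
    fine (\int[mu]_(s in [set: R]) (gau s)%:E).
Proof.
move=> gau; have one0 : (1 : R) != 0 by [].
have p0 : 0 < normal_peak (1 : R) by exact: normal_peak_gt0.
(* Integrability of the Gaussian comes with dominated convergence along any admissible sequence;
   [k + 2] is one. *)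
have igau : mu.-integrable [set: R] (EFin \o gau).
  have [] // := @std_chi2_fun_dominated_convergence (fun k => k.+2%:R) [set: R].
  - by move=> k; rewrite ler_nat.
  - apply/cvgryPge => A; near=> k; apply: (@le_trans _ _ k%:R).
      by near: k; exact: nbhs_infty_ger.
    by rewrite ler_nat; exact/leqW/leqW.
have pdfE s : normal_pdf 0 1 s = normal_peak 1 * gau s.
  rewrite normal_pdfE // /normal_fun subr0; congr (_ * expR (_ / _)).
  by rewrite expr1n.
have I D : measurable D -> (\int[mu]_(s in D) (normal_pdf 0 1 s)%:E =
    (normal_peak 1)%:E * \int[mu]_(s in D) (gau s)%:E)%E.
  move=> mD; under eq_integral do rewrite pdfE EFinM.
  by rewrite integralZl //; exact: (integrableS measurableT).
have fD D : measurable D -> (\int[mu]_(s in D) (gau s)%:E)%E \is a fin_num.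
  by move=> mD; rewrite integrable_fin_num //; exact: (integrableS measurableT).
(* Total mass 1 identifies the normalising constant as the inverse of the Gaussian integral. *)
have J : normal_peak 1 * fine (\int[mu]_(s in [set: R]) (gau s)%:E) = 1.
  have := I _ measurableT; rewrite integral_normal_pdf -[X in (_ * X)%E]fineK ?fD //.
  by rewrite -EFinM => -[].
have J0 : 0 < fine (\int[mu]_(s in [set: R]) (gau s)%:E).
  by rewrite -(pmulr_rgt0 _ p0) J.
split => //; rewrite /std_normal_cdf /normal_prob I // fineM // ?fD //.
apply: (mulIf (lt0r_neq0 J0)); rewrite divfK ?gt_eqF //.
by rewrite mulrAC J mul1r.
Unshelve. all: by end_near. Qed.

Lemma Kf_cdf_cvg_normal (f : nat -> R) (x : R) : f @ \oo --> +oo%R ->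
  (fun k => Kf_cdf (f k) x) @ \oo --> std_normal_cdf x.
Proof.
(* Truncation at 2 gives the domination for every index; once [f k >= 8] it has no effect and
   [2 * m k ^+ 2 = f k]. *)
move=> foo; pose m k := Num.max 2 (Num.sqrt (f k / 2)).
have m2 k : 2 <= m k by rewrite le_max lexx.
have moo : m @ \oo --> +oo%R.
  apply/cvgryPge => A; near=> k.
  have fk : 2 * (`|A| ^+ 2) <= f k by near: k; move/cvgryPge: foo; exact.
  rewrite le_max; apply/orP; right; apply: (le_trans (ler_norm A)).
  rewrite -[leLHS]ger0_norm // -sqrtr_sqr ler_wsqrtr //; lra.
apply: (@cvg_trans _ ((fun k => Kf_cdf (2 * m k ^+ 2) x) @ \oo)).
  apply: near_eq_cvg; near=> k; congr Kf_cdf.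
  have fk : 8 <= f k by near: k; move/cvgryPge: foo; exact.
  have f0 : 0 <= f k / 2 by lra.
  have s2 : 2 <= Num.sqrt (f k / 2).
    rewrite -[leLHS]ger0_norm // -sqrtr_sqr ler_wsqrtr //; lra.
  by rewrite /m max_r // sqr_sqrtr //; field.
have [G0 ->] := std_normal_cdfE x.
have [i1 c1] := @std_chi2_fun_dominated_convergence m `]-oo, x]%classic (measurable_itv _) m2 moo.
have [i2 c2] := @std_chi2_fun_dominated_convergence m [set: R] measurableT m2 moo.
under eq_cvg do rewrite Kf_cdf_std //.
apply: cvgM; last apply: cvgV; first 1 last.
- by rewrite gt_eqF.
- by apply: fine_cvg; rewrite fineK // integrable_fin_num.
- by apply: fine_cvg; rewrite fineK // integrable_fin_num.
Unshelve. all: by end_near. Qed.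

End chi2_large_f.

(** * Degrees of freedom near one *)

Section chi2_bounded_f.
Context {R : realType}.
Local Notation mu := (@lebesgue_measure R).

(** The primitive is [t^p / p]; the bound does not depend on [e], which allows [e] to tend to 0. *)
Lemma integral_powR_le (p e : R) : 0 < p -> 0 < e -> e < 1 ->
  (\int[mu]_(t in `[e, 1%R]) (t `^ (p - 1))%:E <= p^-1%:E)%E.
Proof.
move=> p0 e0 e1.
have d (t : R) : 0 < t -> is_derive t 1 (fun t : R => p^-1 * t `^ p) (t `^ (p - 1)).
  move=> t0; have dt := is_derive1_powR p t0.
  apply: is_derive_eq; rewrite /GRing.scale /= mulrA mulVf ?mul1r //.
  by rewrite gt_eqF.
have c (q t : R) : 0 < t -> {for t, continuous (fun t : R => t `^ q)}.
  move=> t0; apply/differentiable_continuous/derivable1_diffP.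
  by apply: derivable_powR; rewrite in_itv /= t0.
rewrite (@continuous_FTC2 _ _ (fun t : R => p^-1 * t `^ p)) //.
- rewrite -EFinB lee_fin powR1 mulr1 gerBl mulr_ge0 ?powR_ge0 //.
  by rewrite invr_ge0 ltW.
- apply: derivable_within_continuous => t; rewrite in_itv /= => /andP [et _].
  by apply: derivable_powR; rewrite in_itv /= (lt_le_trans e0 et).
- split.
  + move=> t; rewrite in_itv /= => /andP [et _].
    by have [] := d t (lt_trans e0 et).
  + apply: cvg_at_right_filter; apply: cvgMr; exact: c.
  + apply: cvg_at_left_filter; apply: cvgMr; exact: c.
- move=> t; rewrite in_itv /= => /andP [et _]; rewrite derive1E.
  by have [_ ->] := d t (lt_trans e0 et).
Qed.

Lemma integrable_powR (p : R) : 0 < p ->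
  mu.-integrable `]0%R, 1%R] (fun t => (t `^ (p - 1))%:E).
Proof.
move=> p0.
have mf D : measurable D -> measurable_fun D (fun t : R => (t `^ (p - 1))%:E).
  by move=> mD; apply/measurable_EFinP; apply: measurable_funTS; exact: measurable_powR.
apply/integrableP; split; first exact: mf.
under eq_integral do rewrite gee0_abs ?lee_fin ?powR_ge0 //.
(* The shift by two keeps the left end strictly below 1 for every [n]. *)
pose F n := `[(n.+2%:R : R)^-1, 1%R]%classic.
have UF : `]0%R, 1%R]%classic = \bigcup_n F n.
  apply/seteqP; split => t /=; rewrite in_itv /=.
  - move=> /andP [t0 t1]; exists (Num.truncn t^-1) => //=.
    rewrite /F /= in_itv /= t1 andbT -[leRHS]invrK lef_pV2 ?posrE ?invr_gt0 //.
    have /ltW h := truncnS_gt t^-1; apply: (le_trans h).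
    by rewrite ler_nat.
  - move=> [n _] /=; rewrite /F /= in_itv /= => /andP [nt ->]; rewrite andbT.
    by apply: lt_le_trans nt; rewrite invr_gt0.
have cv : (\int[mu]_(t in F n) (t `^ (p - 1))%:E)%E @[n --> \oo] -->
    (\int[mu]_(t in `]0%R, 1%R]) (t `^ (p - 1))%:E)%E.
  rewrite UF; apply: ge0_nondecreasing_set_cvg_integral => //.
  - move=> i j ij; apply/subsetPset => t; rewrite /F /= !in_itv /= => /andP [h ->].
    rewrite andbT; apply: le_trans h; rewrite lef_pV2 ?posrE //.
    by rewrite ler_nat !ltnS.
  - by move=> i; exact: measurable_itv.
  - by move=> i; apply: mf; exact: measurable_itv.
  - by move=> i t _; rewrite lee_fin powR_ge0.
apply: (@le_lt_trans _ _ (p^-1)%:E); last exact: ltry.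
apply: (cvge_le _ cv); near=> n.
by apply: integral_powR_le => //; rewrite ?invr_gt0 // invf_lt1 // ltr1n.
Unshelve. all: by end_near. Qed.

(** For [f] in [[1/2, 2]] the exponent [f / 2 - 1] lies in [[-3/4, 0]]. On []0, 1]] the power is
    therefore at most [t^(-3/4)]; beyond 1 it is at most 1 and the exponential factor remains. *)
Definition chi2_dom (t : R) : R :=
  ((fun t => t `^ (4^-1 - 1)) \_ `]0, 1]) t + 4 * exponential_pdf 2^-1 t.

Lemma chi2_fun_le_dom (f t : R) : 2^-1 <= f <= 2 -> chi2_fun f t <= chi2_dom t.
Proof.
move=> /andP [f1 f2]; rewrite /chi2_dom /chi2_fun patchE.
have E0 : 0 <= exponential_pdf (2^-1 : R) t by exact: exponential_pdf_ge0.
have [t0|t0] := ltP 0 t; last first.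
  by rewrite addr_ge0 ?mulr_ge0 //; case: ifP => // _; exact: powR_ge0.
have Et : expR (- t / 2) <= 4 * exponential_pdf 2^-1 t.
  rewrite exponential_pdfE ?(ltW t0) //; have -> : - t / 2 = - 2^-1 * t by field.
  have := expR_ge0 (- 2^-1 * t); lra.
have e1 : expR (- t / 2) <= 1 by rewrite -[leRHS]expR0 ler_expR; lra.
have [t1|t1] := leP t 1.
- rewrite ifT; last by rewrite inE /= in_itv /= t0 t1.
  apply: (@le_trans _ _ (t `^ (f / 2 - 1))).
    by rewrite ler_piMr ?powR_ge0.
  rewrite ler_wpDr ?mulr_ge0 //; apply: ger_powR; first by rewrite t0.
  lra.
- rewrite ifF; last by apply/negbTE/negP; rewrite inE /= in_itv /= => /andP [_]; rewrite leNgt t1.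
  rewrite add0r; apply: le_trans Et; rewrite ler_piMl ?expR_ge0 //.
  rewrite -[leRHS](powRr0 t); apply: ler_powR; [exact: ltW|lra].
Qed.

Lemma integrable_chi2_dom : mu.-integrable [set: R] (EFin \o chi2_dom).
Proof.
have -> : EFin \o chi2_dom =
  (((fun t => (t `^ (4^-1 - 1))%:E) \_ `]0%R, 1%R]) \+
  (fun t => (4%:E * (exponential_pdf 2^-1 t)%:E)%E))%E.
  by apply/funext => t; rewrite /chi2_dom /= !patchE EFinD; case: ifP.
apply: integrableD => //.
  have i1 : 0 < (4^-1 : R) by rewrite invr_gt0.
  exact: (@integrable_mkcond _ _ _ mu _ _ (measurable_itv `]0%R, 1%R])).1 (integrable_powR i1).
apply: integrableZl => //; apply: integrable_exponential_pdf.
by rewrite invr_gt0.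
Qed.

Lemma integrable_chi2_fun (f : R) (D : set R) : measurable D -> 2^-1 <= f <= 2 ->
  mu.-integrable D (EFin \o chi2_fun f).
Proof.
move=> mD hf; apply: (@le_integrable _ _ _ mu _ mD _ (EFin \o chi2_dom)).
- by apply/measurable_EFinP; apply: measurable_funTS; exact: measurable_chi2_fun.
- move=> s _ /=; rewrite lee_fin ger0_norm ?chi2_fun_ge0 //.
  by apply: (le_trans (chi2_fun_le_dom s hf)); exact: ler_norm.
- by apply: (integrableS measurableT) => //; exact: integrable_chi2_dom.
Qed.

(** On [[1, 2]] the function stays above [c], because there [0 <= ln t <= 2] and [t / 2 <= 1]. *)
Lemma integral_chi2_fun_gt0 (f : R) : 2^-1 <= f <= 2 ->
  0 < fine (\int[mu]_(t in [set: R]) (chi2_fun f t)%:E).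
Proof.
move=> hf; pose c := expR (- `|f / 2 - 1| * 2 - 1).
have cb t : `[1, 2]%classic t -> c <= chi2_fun f t.
  rewrite /= in_itv /= => /andP [t1 t2].
  have t0 : 0 < t by lra.
  rewrite /chi2_fun t0 /powR gt_eqF // -expRD ler_expR.
  have l0 : 0 <= ln t by rewrite ln_ge0.
  have l2 : ln t <= 2 by apply: le_trans t2; apply/ltW/ln_sublinear.
  have := ler_norm (- (f / 2 - 1)); rewrite normrN => h.
  have : - `|f / 2 - 1| * 2 <= (f / 2 - 1) * ln t.
    apply: (@le_trans _ _ (- `|f / 2 - 1| * ln t)).
      by rewrite !mulNr lerN2 ler_wpM2l.
    by rewrite ler_wpM2r //; lra.
  lra.
have fin D : measurable D -> (\int[mu]_(t in D) (chi2_fun f t)%:E)%E \is a fin_num.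
  by move=> mD; rewrite integrable_fin_num //; exact: integrable_chi2_fun.
rewrite fine_gt0 // ltey_eq fin // andbT.
apply: (@lt_le_trans _ _ (\int[mu]_(t in `[1%R, 2%R]) (chi2_fun f t)%:E)%E); last first.
  apply: ge0_subset_integral => //.
  - by apply/measurable_EFinP; exact: measurable_chi2_fun.
  - by move=> t _; rewrite lee_fin chi2_fun_ge0.
apply: (@lt_le_trans _ _ (\int[mu]_(t in `[1%R, 2%R]) (cst c%:E) t)%E).
  rewrite integral_cst //= lebesgue_measure_itv /= lte_fin ltr1n -EFinB -EFinM lte_fin.
  by rewrite mulr_gt0 ?expR_gt0 //; lra.
apply: ge0_le_integral => //.
- by move=> t _; rewrite lee_fin expR_ge0.
- by apply/measurable_EFinP; apply: measurable_funTS; exact: measurable_chi2_fun.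
Qed.

Lemma cvg_chi2_fun (f : nat -> R) (f0 t : R) : f @ \oo --> f0 ->
  (fun k => chi2_fun (f k) t) @ \oo --> chi2_fun f0 t.
Proof.
move=> ff; rewrite /chi2_fun; case: ifP => t0; last exact: cvg_cst.
apply: cvgMl; rewrite /powR gt_eqF //.
apply: continuous_cvg; first exact: continuous_expR.
apply: cvgMl; apply: cvgB; last exact: cvg_cst.
exact: cvgMl.
Qed.

(** The endpoint moves together with the degrees of freedom, so the domain is turned into an
    indicator on the whole line. Pointwise convergence can fail only at [y0], a null set. *)
Lemma cvg_integral_chi2_fun (f y : nat -> R) (f0 y0 : R) :
  (forall k, 2^-1 <= f k <= 2) -> f @ \oo --> f0 -> y @ \oo --> y0 ->
  (fun k => \int[mu]_(t in `]-oo, y k]) (chi2_fun (f k) t)%:E)%E @ \oo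
    --> (\int[mu]_(t in `]-oo, y0]) (chi2_fun f0 t)%:E)%E.
Proof.
move=> hf ff yy.
under eq_cvg do rewrite integral_mkcond; rewrite integral_mkcond.
have mr g z : measurable_fun [set: R]
    ((fun t => (chi2_fun g t)%:E) \_ `]-oo, z]).
  apply/(measurable_restrictT _ _).1; first exact: measurable_itv.
  by apply/measurable_EFinP; apply: measurable_funTS; exact: measurable_chi2_fun.
have [||||| _ _] := @dominated_convergence _ _ R mu [set: R] measurableT
  (fun k => (fun t => (chi2_fun (f k) t)%:E) \_ `]-oo, y k])
  ((fun t => (chi2_fun f0 t)%:E) \_ `]-oo, y0]) (EFin \o chi2_dom) => //.
- by move=> k; exact: mr.
- exact: mr.
- exists [set y0]; split => //; first exact: lebesgue_measure_set1.
  move=> t nt; apply: contrapT => ty; apply: nt => _.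
  have {}ty : t != y0 by apply/eqP => tE; apply: ty.
  rewrite patchE.
  have [ty0|ty0] := ltP t y0.
  + rewrite ifT; last by rewrite inE /= in_itv /= ltW.
    apply: (@cvg_trans _ ((fun k => (chi2_fun (f k) t)%:E) @ \oo)).
      apply: near_eq_cvg; near=> k; rewrite patchE ifT // inE /= in_itv /=.
      by near: k; apply: (cvgr_ge y0 yy).
    apply/fine_cvgP; split; first by near=> k.
    exact: cvg_chi2_fun.
  + have {}ty0 : y0 < t by rewrite lt_neqAle eq_sym ty.
    rewrite ifF; last by apply/negbTE/negP; rewrite inE /= in_itv /= leNgt ty0.
    apply: (@cvg_trans _ ((fun k : nat => 0%E : \bar R) @ \oo)); last exact: cvg_cst.
    apply: near_eq_cvg; near=> k; rewrite patchE ifF //; apply/negbTE/negP.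
    rewrite inE /= in_itv /= leNgt => /negP; apply.
    by near: k; apply: (cvgr_lt y0 yy).
- exact: integrable_chi2_dom.
- apply: aeW => t k _ /=; rewrite patchE; case: ifP => _.
    by rewrite lee_fin ger0_norm ?chi2_fun_ge0 // chi2_fun_le_dom.
  rewrite abse0 lee_fin; exact: le_trans (chi2_fun_ge0 _ _) (chi2_fun_le_dom t (hf 0%N)).
Unshelve. all: by end_near. Qed.

Lemma Kf_cdf_cvg1 (f : nat -> R) (x : R) : f @ \oo --> (1 : R) ->
  (fun k => Kf_cdf (f k) x) @ \oo --> Kf_cdf 1 x.
Proof.
(* Clamping to [[1/2, 2]] makes the dominating function valid for every index and changes only
   finitely many terms. *)
move=> ff; pose g k := Num.max 2^-1 (Num.min (f k) 2).
have hg k : 2^-1 <= g k <= 2.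
  by rewrite /g le_max lexx /= ge_max ge_min lexx orbT andbT; lra.
have fg : \forall k \near \oo, g k = f k.
  near=> k; rewrite /g min_l ?max_r //.
    by near: k; apply: (cvgr_ge 1 ff); lra.
  by near: k; apply: (cvgr_le 1 ff); lra.
have gg : g @ \oo --> (1 : R).
  apply: cvg_trans ff; apply: near_eq_cvg; near=> k; apply/esym.
  by near: k; exact: fg.
apply: (@cvg_trans _ ((fun k => Kf_cdf (g k) x) @ \oo)).
  apply: near_eq_cvg; near=> k; congr Kf_cdf.
  by near: k; exact: fg.
have h1 : 2^-1 <= (1 : R) <= 2 by apply/andP; split; lra.
have yy : (fun k => g k + x * Num.sqrt (2 * g k)) @ \oo --> 1 + x * Num.sqrt (2 * 1).
  apply: cvgD => //; apply: cvgMr.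
  by apply: continuous_cvg; [exact: sqrt_continuous|exact: cvgMr].
rewrite /Kf_cdf /chi2_cdf.
apply: cvgM.
  apply: fine_cvg; rewrite fineK ?integrable_fin_num //; last first.
    by apply: integrable_chi2_fun => //; exact: measurable_itv.
  exact: cvg_integral_chi2_fun.
apply: cvgV; first by rewrite gt_eqF // integral_chi2_fun_gt0.
apply: fine_cvg; rewrite fineK ?integrable_fin_num //; last first.
  exact: integrable_chi2_fun.
have [||||| _ _] := @dominated_convergence _ _ R mu [set: R] measurableT
  (fun k t => (chi2_fun (g k) t)%:E) (EFin \o chi2_fun 1) (EFin \o chi2_dom) => //.
- by move=> k; apply/measurable_EFinP; exact: measurable_chi2_fun.
- by apply/measurable_EFinP; exact: measurable_chi2_fun.
- apply: aeW => t _; apply/fine_cvgP; split; first by near=> k.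
  exact: cvg_chi2_fun.
- exact: integrable_chi2_dom.
- by apply: aeW => t k _ /=; rewrite lee_fin ger0_norm ?chi2_fun_ge0 // chi2_fun_le_dom.
Unshelve. all: by end_near. Qed.

End chi2_bounded_f.

(** * From limits of [beta1] to limits of the standardised law *)

Theorem theorem3 (R : realType)
  (a d : nat -> nat) (n : forall k, 'I_(a k) -> nat)
  (Sigma : forall k, 'M[R]_(d k)) (Mu : forall k, 'M[R]_(a k, d k))
  (TW : forall k, 'M[R]_(a k)) (TS : forall k, 'M[R]_(d k))
  (lam : nat -> seq R) :
  (forall k (i : 'I_(a k)), (0 < n k i)%N) ->
  (forall k, posdef (Sigma k)) ->
  (forall k, sym_idem_nz (TW k)) ->
  (forall k, sym_idem_nz (TS k)) ->
  (* H_0(T): T mu = 0 *)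
  (forall k, Tmat (TW k) (TS k) *m stack_mu (Mu k) = 0) ->
  asymp_framework a d n ->
  (* lam k = eigenvalues of T V_N T (with multiplicity), in decreasing order *)
  (forall k, sorted >=%R (lam k) /\
     char_poly (Tmat (TW k) (TS k) *m VN (n k) (Sigma k) *m Tmat (TW k) (TS k))
       = \prod_(x <- lam k) ('X - x%:P)) ->
  let f := fun k => fP (Tmat (TW k) (TS k)) (VN (n k) (Sigma k)) in
  ((fun k => beta1 (lam k)) @ \oo --> (0 : R) ->
     cvg_in_dist (fun k => Kf_cdf (f k)) std_normal_cdf) /\
  ((fun k => beta1 (lam k)) @ \oo --> (1 : R) ->
     cvg_in_dist (fun k => Kf_cdf (f k)) (Kf_cdf 1)).
Proof.
move=> n0 pS sTW sTS _ _ hlam f.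
have bnd k : [/\ 0 < beta1 (lam k), (beta1 (lam k)) ^- 2 <= f k
    & f k <= (beta1 (lam k)) ^- 6].
  have [srt hl] := hlam k.
  have hT : sym_idem_nz (Tmat (TW k) (TS k)) by exact: sym_idem_nz_kron.
  have hV : posdef (VN (n k) (Sigma k)) by exact: posdef_VN.
  rewrite /f /fP !(tr_compression_exp hT hl).
  apply: fP_bounds => //; first exact: (compression_eigenvalue_ge0 hT hV hl).
  exact: (compression_sum_gt0 hT hV hl).
split=> b x _.
- apply: Kf_cdf_cvg_normal; apply/cvgryPge => A; near=> k.
  have [b0 + _] := bnd k; apply: le_trans.
  have A0 : 0 < `|A| + 1 by rewrite ltr_wpDl.
  (* This threshold yields [beta1^-2 >= (|A| + 1)^2 >= A]. *)
  have bA : beta1 (lam k) < (`|A| + 1)^-1.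
    by near: k; apply: (cvgr_lt 0 b); rewrite invr_gt0.
  have iA : `|A| + 1 < (beta1 (lam k))^-1.
    by rewrite -[ltLHS]invrK ltf_pV2 // posrE invr_gt0.
  have := ler_norm A; rewrite -exprVn; have := normr_ge0 A; nra.
- apply: Kf_cdf_cvg1.
  (* Both bounds on [f k] are inverse powers of [beta1], so they share the limit 1 and squeeze
     [f k]. *)
  have c j : (fun k => (beta1 (lam k)) ^- j) @ \oo --> (1 : R).
    rewrite -[X in _ --> X]invr1; apply: cvgV => //.
    rewrite -[X in _ --> X](expr1n R j).
    by apply: (cvg_comp _ (fun x : R => x ^+ j) b); exact: exprn_continuous.
  apply: (squeeze_cvgr _ (c 2%N) (c 6%N)); near=> k.
  by have [_ -> ->] := bnd k.
Unshelve. all: by end_near. Qed.
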